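(* Let $m\geq1$ and $k$ be integers with $\gcd(m,k)=1$ and $m-2k\equiv0$ mod $4$, and let $J_4(m,k)=\langle t,y\mid t^4,\ y^{m-k}t^3y^kt^2\rangle$. Then $$J_4(m,k)'\cong\begin{cases}\mathbb{Z}_{2^{m/2}-1}\oplus\mathbb{Z}_{2^{m/2}-1}&\text{if }m-2k\equiv0\text{ mod }8,\\ \mathbb{Z}_{2^{m/2}+1}\oplus\mathbb{Z}_{2^{m/2}+1}&\text{if }m-2k\equiv4\text{ mod }8.\end{cases}$$
   Context: $G'$ denotes the derived subgroup of $G$, and $\mathbb{Z}_q$ the cyclic group of order $q$ (trivial for $q=1$). The hypothesis forces $m$ to be even. *)

(* Defs.v *)
From HB Require Import structures.
From mathcomp Require Import all_boot all_algebra.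
From mathcomp Require Import boolp.

Set Implicit Arguments.
Unset Strict Implicit.
Unset Printing Implicit Defensive.

Local Open Scope group_scope.
Local Open Scope quotient_scope.

(* Words in the letters x and x^-1 for x in X; (x, true) stands for x^-1. *)
Definition word (X : choiceType) : choiceType := seq (X * bool)%type.

(* The word x^n, for n of either sign. *)
Definition wpow (X : choiceType) (x : X) (n : int) : word X :=
  match n with
  | Posz p => nseq p (x, false)
  | Negz p => nseq p.+1 (x, true)
  end.

Definition winv (X : choiceType) (u : word X) : word X :=
  rev [seq (a.1, ~~ a.2) | a <- u].

(* The congruence on words whose classes form the group < X | R >. *)
Inductive pres_rel (X : choiceType) (R : seq (word X)) :
    word X -> word X -> Prop :=
| PresRefl u : pres_rel R u u
| PresSym u v : pres_rel R u v -> pres_rel R v u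
| PresTrans u v w : pres_rel R u v -> pres_rel R v w -> pres_rel R u w
| PresCat u u' v v' :
    pres_rel R u u' -> pres_rel R v v' -> pres_rel R (u ++ v) (u' ++ v')
| PresCancel x b : pres_rel R [:: (x, b); (x, ~~ b)] [::]
| PresRelator r : r \in R -> pres_rel R r [::].

Section Presented.
Variables (X : choiceType) (R : seq (word X)).
Implicit Types u v : word X.

Definition pres_eqb : rel (word X) := fun u v => `[< pres_rel R u v >].

Lemma pres_eqb_equiv : equiv_class_of pres_eqb.
Proof.
split=> [u|u v|v u w].
- exact/asboolP/PresRefl.
- by apply/asboolP/asboolP; apply: PresSym.
- by move=> /asboolP uv /asboolP vw; apply/asboolP/(PresTrans uv vw).
Qed.

Canonical pres_eqb_equiv_rel := EquivRelPack pres_eqb_equiv.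

Definition presented : Type := {eq_quot pres_eqb}.
HB.instance Definition _ := EqQuotient.on presented.
HB.instance Definition _ := Choice.on presented.

Definition pclass (u : word X) : presented := \pi_presented u.

Lemma pclassP u v : pclass u = pclass v <-> pres_rel R u v.
Proof.
split=> [/eqmodP/asboolP //|uv]; exact/eqmodP/asboolP.
Qed.

Lemma pres_rel_winvl u : pres_rel R (winv u ++ u) [::].
Proof.
elim: u => [|[x b] u IH]; first exact: PresRefl.
rewrite /winv /= rev_cons -cats1 -catA /=.
apply: PresTrans IH; apply: PresCat (PresRefl _ _) _.
rewrite -[X in pres_rel _ _ X]cat0s.
rewrite -[(x, ~~ b) :: _]/([:: (x, ~~ b); (x, b)] ++ u).
apply: PresCat (PresRefl _ _).
by have := PresCancel R x (~~ b); rewrite negbK.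
Qed.

Lemma winvK : involutive (@winv X).
Proof.
move=> u; rewrite /winv map_rev revK -map_comp -[RHS]map_id.
by apply: eq_map => -[x b] /=; rewrite negbK.
Qed.

Definition pres_one : presented := pclass [::].
Definition pres_mul (x y : presented) : presented := pclass (repr x ++ repr y).
Definition pres_inv (x : presented) : presented := pclass (winv (repr x)).

Lemma pclass_repr (x : presented) : pclass (repr x) = x.
Proof. exact: reprK. Qed.

Lemma repr_pclass u : pres_rel R (repr (pclass u)) u.
Proof. exact/pclassP/pclass_repr. Qed.

Lemma pclass_cat u v : pclass (u ++ v) = pres_mul (pclass u) (pclass v).
Proof. by apply/pclassP/PresSym/PresCat; exact: repr_pclass. Qed.

Lemma pres_mulA : associative pres_mul.
Proof.
move=> x y z; rewrite -(pclass_repr x) -(pclass_repr y) -(pclass_repr z).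
by rewrite -!pclass_cat catA.
Qed.

Lemma pres_mul1 : left_id pres_one pres_mul.
Proof. by move=> x; rewrite -(pclass_repr x) -pclass_cat. Qed.

Lemma pres_1mul : right_id pres_one pres_mul.
Proof. by move=> x; rewrite -(pclass_repr x) -pclass_cat cats0. Qed.

Lemma pres_mulV : left_inverse pres_one pres_inv pres_mul.
Proof.
move=> x; rewrite -{2}(pclass_repr x) -pclass_cat.
exact/pclassP/pres_rel_winvl.
Qed.

Lemma pres_Vmul : right_inverse pres_one pres_inv pres_mul.
Proof.
move=> x; rewrite -{1}(pclass_repr x) -pclass_cat; apply/pclassP.
by have := pres_rel_winvl (winv (repr x)); rewrite winvK.
Qed.

HB.instance Definition _ :=
  isGroup.Build presented pres_mulA pres_mul1 pres_1mul pres_mulV pres_Vmul.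

End Presented.

Definition pgen (X : choiceType) (R : seq (word X)) (x : X) : presented R :=
  pclass R [:: (x, false)].

Definition weval (X : choiceType) (G : groupType) (f : X -> G) (u : word X) : G :=
  \prod_(a <- u) (if a.2 then (f a.1)^-1 else f a.1).

(* The universal property that characterizes < X | R >. *)
Lemma presented_ump (X : choiceType) (R : seq (word X)) (G : groupType)
    (f : X -> G) :
  {in R, forall r, weval f r = 1} ->
  exists2 h : {multiplicative presented R -> G},
    forall x, h (pgen R x) = f x
    & forall h' : {multiplicative presented R -> G},
        (forall x, h' (pgen R x) = f x) -> h' =1 h.
Proof.
move=> fR.
have evalP u v : pres_rel R u v -> weval f u = weval f v.
  elim=> // {u v} [u v w _ -> _ -> //|u u' v v' _ IHu _ IHv|x b|r /fR -> //].
  - by rewrite /weval !big_cat -!/(weval f _) IHu IHv.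
  - by rewrite /weval !big_cons !big_nil mulg1 /=; case: b; rewrite ?mulVg ?mulgV.
  - by rewrite /weval big_nil.
pose h (x : presented R) := weval f (repr x).
have hE u : h (pclass R u) = weval f u by apply/evalP/repr_pclass.
have hM : {morph h : x y / x * y}.
  move=> x y; rewrite -(pclass_repr x) -(pclass_repr y) -[_ * _]pclass_cat !hE.
  by rewrite /weval big_cat.
pose hm : {multiplicative presented R -> G} :=
  Multiplicative.Pack (Multiplicative.Class (isMultiplicative.Build _ _ h hM)).
exists hm => [x|h' h'f x].
  by rewrite /= hE /weval big_seq1.
rewrite -(pclass_repr x) /= hE; elim: (repr x) => [|[y b] u IH].
  rewrite /weval big_nil; apply: (mulgI (h' (pclass R [::]))).
  by rewrite mulg1 -gmulfM; congr (h' _); exact: (mul1g (1 : presented R)).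
rewrite -cat1s [pclass _ _]pclass_cat [h' _]gmulfM IH /weval big_cons; congr (_ * _).
have h'1 : h' 1 = 1 by apply: (mulgI (h' 1)); rewrite mulg1 -gmulfM mulg1.
case: b => /=; last exact: h'f.
apply: (mulgI (f y)); rewrite mulgV -{1}h'f -gmulfM -h'1; congr (h' _).
by rewrite -[LHS]pclass_cat; apply/pclassP; exact: (PresCancel R y false).
Qed.

(* The commutator subgroup: the smallest subgroup containing all commutators. *)
Definition derived_pred (G : groupType) : {pred G} := fun z =>
  `[< forall H : {pred G}, group_closed H ->
        (forall x y : G, [~ x, y] \in H) -> z \in H >].

Lemma derived_group_closed (G : groupType) : group_closed (@derived_pred G).
Proof.
split=> [|u v /asboolP Du /asboolP Dv]; apply/asboolP => H HG HR.
  by case: HG.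
by apply: HG.2; [exact: Du | exact: Dv].
Qed.

Definition derived (G : groupType) : Type := {z : G | z \in @derived_pred G}.
HB.instance Definition _ (G : groupType) := SubChoice.on (derived G).
HB.instance Definition _ (G : groupType) :=
  SubChoice_isSubGroup.Build G (@derived_pred G) (derived G)
    (@derived_group_closed G).

Definition isomorphic (G H : groupType) : Prop :=
  exists f : {multiplicative G -> H}, bijective f.

(* The cyclic group of order q, for q >= 1, with addition as its group law.
   'Z_q would not do, as it has order 2 when q = 1. *)
Definition cyc (q : nat) : groupType := 'I_q.-1.+1.

Definition J4_t : bool := false.
Definition J4_y : bool := true.

Definition J4 (m k : int) : groupType :=
  presented [:: wpow J4_t 4;
                wpow J4_y (m - k)%R ++ wpow J4_t 3 ++ wpow J4_y k ++ wpow J4_t 2].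

(* Main.v *)
(* Put z = y^m and g = y^k. The second relator says that t^g = t^2 z. Hence t is
   conjugate to t^2 z and t^2 to t z^-1, so that (t z^-1)^2 = 1. This makes
   t^2 z conjugate to z^-1, whence z^4 = 1, and <t, z> is a quotient of the
   Euclidean triangle group (2,4,4), i.e. of Z[i] extended by Z_4. Its
   translations X = z t and Y = t z commute, and since gcd(m, k) = 1 they span a
   normal subgroup, which is J'. On it z acts as multiplication by -i and g as
   multiplication by 1 - i, so g^m = z^k gives 2^(m/2) = (-i)^(k - m/2), which is
   1 or -1: this makes J' a quotient of Z_q + Z_q. The affine action of J on
   Z_q[i] shows that the quotient is not proper. *)

Require Import Defs.
From mathcomp Require Import all_boot all_algebra.
From mathcomp Require Import fingroup perm boolp zify ring.

Set Implicit Arguments.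
Unset Strict Implicit.
Unset Printing Implicit Defensive.

Import GRing.Theory.
Local Open Scope group_scope.

(** * Integer powers in a group *)

Definition zexp (G : groupType) (x : G) (n : int) : G :=
  match n with
  | Posz p => x ^+ p
  | Negz p => x ^- p.+1
  end.

Section Zexp.
Variable G : groupType.
Implicit Types (x y : G) (m n : int).

Lemma zexpN x n : zexp x (- n)%R = (zexp x n)^-1.
Proof. by case: n => [[|p]|p] //=; rewrite ?invg1 ?invgK. Qed.

Lemma zexpDn x n (p : nat) : zexp x (n + p%:Z)%R = zexp x n * x ^+ p.
Proof.
elim: p n => [|p IH] n; first by rewrite addr0 mulg1.
have succ n' : zexp x (n' + 1)%R = zexp x n' * x.
  case: n' => [q|[|q]]; first by rewrite -PoszD addn1 /= expgSr.
    by rewrite /= mulVg.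
  have -> : (Negz q.+1 + 1 = Negz q)%R by lia.
  by rewrite /= [x ^+ q.+2]expgS invgM mulgVK.
by rewrite intS addrA IH succ expgS mulgA.
Qed.

Lemma zexpD x m n : zexp x (m + n)%R = zexp x m * zexp x n.
Proof.
case: n => [p|p]; first exact: zexpDn.
apply: (canRL (mulgK (x ^+ p.+1))); rewrite -zexpDn; congr zexp.
by rewrite NegzE; lia.
Qed.

Lemma zexpM x m n : zexp x (m * n)%R = zexp (zexp x m) n.
Proof.
have nat_case (p : nat) : zexp x (m * p%:Z)%R = zexp x m ^+ p.
  elim: p => [|p IH]; first by rewrite mulr0.
  by rewrite intS mulrDr mulr1 zexpD IH expgS.
case: n => p; first exact: nat_case.
by rewrite NegzE mulrN !zexpN nat_case.
Qed.

Lemma commute_zexp x y n : commute x y -> commute x (zexp y n).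
Proof. by case: n => p cxy /=; [|apply: commuteV]; apply: commuteX. Qed.

Lemma zexpMg x y n : commute x y -> zexp (x * y) n = zexp x n * zexp y n.
Proof.
case: n => p cxy /=; rewrite (expgMn _ cxy) // invgM.
exact/commuteV/commute_sym/commuteV/commuteX2.
Qed.

Lemma zexp_torsion x (N : nat) n : x ^+ N.+1 = 1 -> exists p, zexp x n = x ^+ p.
Proof.
case: n => p xN; first by exists p.
(* The exponents [p.+1] and [N * p.+1] add up to [N.+1 * p.+1], which kills [x]. *)
exists (N * p.+1)%N; apply: mulg1_eq.
by rewrite -expgnDr -mulSn expgnA xN expg1n.
Qed.

End Zexp.

(** * Evaluation of words and the second relator *)

Lemma weval_cat (X : choiceType) (G : groupType) (f : X -> G) (u v : word X) :
  weval f (u ++ v) = weval f u * weval f v.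
Proof. exact: big_cat. Qed.

Lemma weval_wpow (X : choiceType) (G : groupType) (f : X -> G) x n :
  weval f (wpow x n) = zexp (f x) n.
Proof.
have weval_nseq b p :
    weval f (nseq p (x, b)) = (if b then (f x)^-1 else f x) ^+ p.
  elim: p => [|p IH]; first by rewrite /weval big_nil.
  by rewrite expgS -IH /weval big_cons.
by case: n => p; rewrite weval_nseq //= -expVgn.
Qed.

Lemma pclassE (X : choiceType) (R : seq (word X)) (u : word X) :
  pclass R u = weval (pgen R) u.
Proof.
elim: u => [|[x b] u IH]; first by rewrite /weval big_nil.
rewrite -cat1s pclass_cat IH weval_cat; congr (_ * _).
rewrite /weval big_seq1 /=; case: b => //=.
apply/esym/mulg1_eq; rewrite /pgen -[LHS]pclass_cat.
by apply/pclassP; exact: (PresCancel R x false).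
Qed.

(** Since [t ^+ 3] is [t^-1], the relator is $y^m (t^g)^{-1} t^2$ with $g = y^k$. *)
Lemma J4_relatorE (G : groupType) (t y : G) (m k : int) : t ^+ 4 = 1 ->
  zexp y (m - k)%R * (t ^+ 3 * (zexp y k * t ^+ 2)) = 1 <->
  t ^ zexp y k = t ^+ 2 * zexp y m.
Proof.
move=> t4.
have t3 : t ^+ 3 = t^-1 by apply/esym/mulg1_eq; rewrite -expgS.
set g := zexp y k.
have -> : zexp y (m - k)%R * (t ^+ 3 * (g * t ^+ 2)) =
    zexp y m * (t ^ g)^-1 * t ^+ 2.
  by rewrite zexpD zexpN t3 -conjVg conjgE !mulgA.
split=> [/eqP|->]; last by rewrite invgM mulVKg mulVg.
by rewrite mulg_eq1 divg_eq => /eqP ->; rewrite mulVKg.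
Qed.

Lemma cubeV_order4 (G : groupType) (x : G) : x ^+ 4 = 1 -> x * x * x = x^-1.
Proof. by move=> x4; apply/esym/mulg1_eq; rewrite -!mulgA. Qed.

Lemma sqV_order4 (G : groupType) (x : G) :
  x ^+ 4 = 1 -> x^-1 * x^-1 = x * x.
Proof. by move=> x4; rewrite -invgM; apply: mulg1_eq; rewrite -mulgA. Qed.

(** * Consequences of [t ^ g = t ^+ 2 * z]: the Euclidean triangle group (2,4,4) *)

Section TriangleRelations.
Variables (G : groupType) (t z g : G).
Hypotheses (t4 : t ^+ 4 = 1) (zg : commute z g) (tg : t ^ g = t ^+ 2 * z).

Lemma conj_z_g : z ^ g = z.
Proof. by rewrite conjgE zg mulKg. Qed.

(** As [g] fixes [z], conjugating [tg] by [g^-1] shows that [t * z^-1] is conjugate to [t ^+ 2]; its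
    square is therefore trivial and it equals its inverse. *)
Lemma tzV_sym : t * z^-1 = z * t^-1.
Proof.
have e : t * z^-1 = (t ^+ 2) ^ g^-1.
  by rewrite -{1}(conjgK g t) tg conjMg -{1}conj_z_g conjgK mulgK.
have : (t * z^-1) * (t * z^-1) = 1.
  by rewrite e -conjMg -expgnDr t4 conj1g.
by move/mulg1_eq => <-; rewrite invgM invgK.
Qed.

Lemma Vtz_sym : z^-1 * t = t^-1 * z.
Proof.
by apply: (mulgI z); rewrite mulVKg mulgA -tzV_sym mulgVK.
Qed.

(* [t ^+ 2 * z] is conjugate both to [t] and to [z^-1]. *)
Lemma order4_z : z ^+ 4 = 1.
Proof.
have e : (t ^+ 2 * z) ^ t^-1 = z^-1.
  by rewrite conjgE invgK !mulgA (cubeV_order4 t4) -Vtz_sym mulgK.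
by rewrite -(invgK z) expVgn -e -conjXg -tg -conjXg t4 !conj1g invg1.
Qed.

Let X := z * t.
Let Y := t * z.

(** Both squares equal their inverses, so $XY = zt^{-1} \cdot t^{-1}z = tz^{-1} \cdot z^{-1}t =
    tz^2t = YX$. *)
Lemma zt_tz_commute : commute X Y.
Proof.
rewrite /commute; have -> : X * Y = z * t^-1 * (t^-1 * z).
  by rewrite /X /Y !mulgA -(mulgA z t^-1) (sqV_order4 t4) !mulgA.
by rewrite -tzV_sym -Vtz_sym /X /Y !mulgA -(mulgA t z^-1) (sqV_order4 order4_z)
  !mulgA.
Qed.

Lemma conj_tz_t : Y ^ t = X.
Proof. by rewrite /X /Y conjgE !mulgA mulVg mul1g. Qed.

Lemma conj_zt_z : X ^ z = Y.
Proof. by rewrite /X /Y conjgE !mulgA mulVg mul1g. Qed.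

Lemma conj_tz_z : Y ^ z = X^-1.
Proof.
rewrite /X /Y conjgE !mulgA Vtz_sym -!mulgA.
by rewrite [z * (z * z)]mulgA (cubeV_order4 order4_z) invgM.
Qed.

Lemma conj_zt_g : X ^ g = X * Y.
Proof. by rewrite conjMg tg conj_z_g /X /Y expg2 !mulgA. Qed.

Lemma conj_tz_g : Y ^ g = Y * X^-1.
Proof.
rewrite conjMg tg conj_z_g /X /Y invgM !mulgA -(mulgA t z) -tzV_sym.
by rewrite -!mulgA (sqV_order4 order4_z).
Qed.

End TriangleRelations.

(** * The derived subgroup is spanned by [X] and [Y], whose orders divide [q] *)

Lemma expg_modn (G : groupType) (x : G) q a : x ^+ q = 1 -> x ^+ (a %% q) = x ^+ a.
Proof.
by move=> xq; rewrite {2}(divn_eq a q) expgnDr mulnC expgnA xq expg1n mul1g.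
Qed.

(* In the paper's notation m = 2n; the flag [s] tells whether m - 2k is 4 or 0
   modulo 8, that is, whether k is n + 2 or n modulo 4. *)
Section DerivedSubgroup.
Variables (G : groupType) (t y : G) (n : nat) (k j : int) (s : bool).
Let z := y ^+ (2 * n).
Let g := zexp y k.
Let X := z * t.
Let Y := t * z.
Let q := if s then (2 ^ n + 1)%N else (2 ^ n - 1)%N.
Hypotheses (n_gt0 : (0 < n)%N) (k_coprime : gcdz (2 * n)%N%:Z k = 1%Z).
Hypotheses (kE : k = (n%:Z + (2 * s)%N%:Z + 4 * j)%R).
Hypotheses (t4 : t ^+ 4 = 1) (tg : t ^ g = t ^+ 2 * z).

Lemma zg_commute : commute z g.
Proof. exact/commute_zexp/commute_sym/commuteX/commute_refl. Qed.

Let z4 : z ^+ 4 = 1 := order4_z t4 zg_commute tg.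
Let XY : commute X Y := zt_tz_commute t4 zg_commute tg.
Let Xz : X ^ z = Y := conj_zt_z t z.
Let Yz : Y ^ z = X^-1 := conj_tz_z t4 zg_commute tg.
Let Xg : X ^ g = X * Y := conj_zt_g zg_commute tg.
Let Yg : Y ^ g = Y * X^-1 := conj_tz_g t4 zg_commute tg.

Lemma y_torsion : y ^+ (8 * n)%N = 1.
Proof.
have -> : (8 * n = 2 * n * 4)%N by lia.
by rewrite expgnA.
Qed.

Lemma conj_X_z2 : X ^ (z ^+ 2) = X^-1.
Proof. by rewrite conjgM Xz Yz. Qed.

(** This is $(1-i)^2 = 2 \cdot (-i)$ in the action on the lattice. *)
Lemma conj_X_g2 : X ^ (g ^+ 2) = (X ^+ 2) ^ z.
Proof.
rewrite conjXg Xz conjgM Xg conjMg Xg Yg.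
by rewrite XY -(mulgA Y) (mulgA X) XY mulgK.
Qed.

Lemma zexp_z_k : zexp z k = z ^+ (n + 2 * s).
Proof.
rewrite kE !zexpD [zexp z (4 * j)]zexpM [zexp z 4]z4 /=.
by rewrite -expgnDr; case: (j) => p; rewrite /= expg1n ?invg1 mulg1.
Qed.

(** Iterating [conj_X_g2] computes the action of $g^{2n} = y^{2nk} = z^k = z^{n+2s}$ on [X].
    Cancelling $z^n$ leaves $X^{2^n} = X^{z^{2s}}$, where $z^2$ acts as inversion. *)
Lemma X_pow2n : X ^+ (2 ^ n) = if s then X^-1 else X.
Proof.
have X_g2i i : X ^ (g ^+ 2 ^+ i) = (X ^+ (2 ^ i)) ^ (z ^+ i).
  elim: i => [|i IH]; first by rewrite !conjg1.
  rewrite [g ^+ 2 ^+ i.+1]expgS conjgM conj_X_g2 -conjgM.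
  have -> : z * g ^+ 2 ^+ i = g ^+ 2 ^+ i * z.
    by do 2!apply: commuteX; exact: zg_commute.
  by rewrite conjgM conjXg IH -conjXg -expgnA -expnSr -conjgM -expgSr.
have gz : g ^+ 2 ^+ n = zexp z k.
  rewrite -expgnA -[LHS]/(zexp g (2 * n)%N) /g /z.
  by rewrite -[y ^+ _]/(zexp y (2 * n)%N) -!zexpM mulrC.
have := X_g2i n; rewrite gz zexp_z_k addnC expgnDr conjgM => /conjg_inj <-.
by case: (s); rewrite ?conj_X_z2 ?conjg1.
Qed.

Lemma q_gt0 : (0 < q)%N.
Proof. by rewrite /q; case: s; rewrite ?addn1 // subn_gt0 -{1}(expn0 2) ltn_exp2l. Qed.

Lemma X_torsion : X ^+ q = 1.
Proof.
have := X_pow2n; rewrite /q; case: s => XE.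
  by rewrite addn1 expgSr XE mulVg.
by apply: (mulgI X); rewrite -expgS subn1 prednK ?expn_gt0 // XE mulg1.
Qed.

Lemma Y_torsion : Y ^+ q = 1.
Proof. by rewrite -Xz -conjXg X_torsion conj1g. Qed.

(** Natural exponents suffice for a subgroup, because [X] and [Y] are torsion. *)
Definition lattice (x : G) : Prop := exists a b : nat, x = X ^+ a * Y ^+ b.

Lemma latticeX : lattice X.
Proof. by exists 1%N, 0%N; rewrite mulg1. Qed.

Lemma latticeY : lattice Y.
Proof. by exists 0%N, 1%N; rewrite mul1g. Qed.

Lemma lattice1 : lattice 1.
Proof. by exists 0%N, 0%N; rewrite mul1g. Qed.

Lemma latticeM u v : lattice u -> lattice v -> lattice (u * v).
Proof.
move=> [a [b ->]] [c [d ->]]; exists (a + c)%N, (b + d)%N.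
rewrite !expgnDr !mulgA; congr (_ * _); rewrite -!mulgA; congr (_ * _).
exact/esym/commuteX2.
Qed.

Lemma latticeXn u p : lattice u -> lattice (u ^+ p).
Proof.
move=> Lu; elim: p => [|p IH]; first exact: lattice1.
by rewrite expgS; apply: latticeM.
Qed.

Lemma latticeV u : lattice u -> lattice u^-1.
Proof.
have Vq x : lattice x -> x ^+ q = 1 -> lattice x^-1.
  move=> Lx xq; have -> : x^-1 = x ^+ q.-1.
    by apply: mulg1_eq; rewrite -expgS (prednK q_gt0).
  exact: latticeXn.
move=> [a [b ->]]; rewrite invgM -!expVgn; apply: latticeM; apply: latticeXn.
  exact: Vq latticeY Y_torsion.
exact: Vq latticeX X_torsion.
Qed.

Definition normalizing x := forall u, lattice u -> lattice (u ^ x).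

Lemma normalizingP x : lattice (X ^ x) -> lattice (Y ^ x) -> normalizing x.
Proof.
move=> LX LY u [a [b ->]].
by rewrite conjMg !conjXg; apply: latticeM; apply: latticeXn.
Qed.

Lemma normalizingXn x p : normalizing x -> normalizing (x ^+ p).
Proof.
move=> Nx; elim: p => [|p IH] u Lu; first by rewrite conjg1.
by rewrite expgSr conjgM; apply/Nx/IH.
Qed.

Lemma normalizing_zexp x (N : nat) i :
  x ^+ N.+1 = 1 -> normalizing x -> normalizing (zexp x i).
Proof.
by move=> xN Nx; have [p ->] := zexp_torsion i xN; exact: normalizingXn.
Qed.

(** By Bezout, [y] is a product of powers of [z] and [g], which act on [X] and [Y] by explicit
    formulas. Both have finite order, so negative powers cause no trouble. *)
Lemma normalizing_y : normalizing y.
Proof.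
have Nz : normalizing z.
  by apply: normalizingP; rewrite ?Xz ?Yz; [exact: latticeY|exact/latticeV/latticeX].
have Ng : normalizing g.
  apply: normalizingP; rewrite ?Xg ?Yg; apply: latticeM.
  - exact: latticeX.
  - exact: latticeY.
  - exact: latticeY.
  - exact/latticeV/latticeX.
have g_torsion : g ^+ (8 * n).-1.+1 = 1.
  rewrite prednK ?muln_gt0 // -[LHS]/(zexp g (8 * n)%N) /g -zexpM mulrC zexpM.
  by rewrite [zexp y (8 * n)%N]y_torsion; case: (k) => p /=; rewrite expg1n ?invg1.
have [u [v uv]] := Bezoutz (2 * n)%N k.
have -> : y = zexp z u * zexp g v.
  have <- : zexp y (u * (2 * n)%N%:Z + v * k)%R = y by rewrite uv k_coprime.
  by rewrite zexpD mulrC [(v * k)%R]mulrC !zexpM.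
move=> w Lw; rewrite conjgM; apply: (normalizing_zexp v g_torsion Ng).
exact: (normalizing_zexp u (N := 3) z4 Nz).
Qed.

Hypothesis generated : forall S : G -> Prop, S 1 ->
  (forall u v, S u -> S v -> S (u * v)) -> (forall u, S u -> S u^-1) ->
  S t -> S y -> forall x, S x.

Lemma normal_form x : exists p a, lattice a /\ x = y ^+ p * a.
Proof.
have yV p : (y ^+ p)^-1 = y ^+ ((8 * n).-1 * p).
  apply: mulg1_eq; rewrite -expgnDr -mulSn prednK ?muln_gt0 //.
  by rewrite expgnA y_torsion expg1n.
move: x; apply: generated.
- by exists 0%N, 1; rewrite mulg1; split=> //; exact: lattice1.
- move=> _ _ [p [a [La ->]]] [r [b [Lb ->]]].
  exists (p + r)%N, (a ^ (y ^+ r) * b); split.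
    by apply: latticeM => //; apply: normalizingXn normalizing_y _ _.
  by rewrite expgnDr -2!(mulgA (y ^+ p)) (mulgA a) (conjgC a) -(mulgA (y ^+ r)).
- move=> _ [p [a [La ->]]]; rewrite invgM yV.
  set r := (_ * p)%N; exists r, (a^-1 ^ (y ^+ r)); split; last exact: conjgC.
  by apply: normalizingXn normalizing_y _ _; exact: latticeV.
(* This power of [y] is [z^-1], and [t = z^-1 * X]. *)
- exists ((8 * n).-1 * (2 * n))%N, X; split; first exact: latticeX.
  by rewrite -yV /X mulKg.
- by exists 1%N, 1; rewrite mulg1; split=> //; exact: lattice1.
Qed.

(** The quotient by the lattice is cyclic, generated by [y]. Concretely, [u * v] and [v * u] have
    normal forms with the same power of [y], which cancels in $[u,v] = (vu)^{-1}uv$. *)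
Lemma lattice_commg u v : lattice [~ u, v].
Proof.
have [p [a [La ->]]] := normal_form u; have [r [b [Lb ->]]] := normal_form v.
have swap i l c d : y ^+ i * c * (y ^+ l * d) = y ^+ (i + l) * (c ^ (y ^+ l) * d).
  by rewrite expgnDr -2!(mulgA (y ^+ i)) (mulgA c) (conjgC c) -(mulgA (y ^+ l)).
have Ny i c : lattice c -> lattice (c ^ (y ^+ i)).
  exact: normalizingXn normalizing_y _.
rewrite commgEl conjgE mulgA -invgM !swap addnC invgM mulgA mulgVK.
by apply: latticeM; [apply: latticeV|]; apply: latticeM => //; exact: Ny.
Qed.

Lemma derivedP x : x \in @derived_pred G <-> lattice x.
Proof.
split=> [/asboolP Dx|[a [b ->]]].
  have := Dx (fun x => `[< lattice x >]); rewrite unfold_in => D.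
  apply/asboolP; apply: D => [|u v].
    split; first exact/asboolP/lattice1.
    by move=> u v /asboolP Lu /asboolP Lv; apply/asboolP/latticeM/latticeV.
  exact/asboolP/lattice_commg.
apply/asboolP => H HG HR.
have HX (u : G) p : u \in H -> u ^+ p \in H.
  move=> Hu; elim: p => [|p IH]; first by case: HG.
  by rewrite expgS; apply: (group_closedM HG).
(* Conversely, [Y] is a commutator, and so is its conjugate [X = Y ^ t]. *)
have YE : Y = [~ t, g] by rewrite commgEl tg /Y expg2 !mulgA mulVg mul1g.
apply: (group_closedM HG); apply: HX; last by rewrite YE.
by rewrite -[X](conj_tz_t t z) -/Y YE conjRg.
Qed.

End DerivedSubgroup.

(** * The affine model over ['Z_q] *)

Lemma common_root (G : groupType) (z g : G) (m k u v : int) :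
  commute z g -> zexp g m = zexp z k -> (u * m + v * k = 1)%R ->
  exists2 y, zexp y m = z & zexp y k = g.
Proof.
move=> zg gm uv; have uvC : (m * u + k * v = 1)%R by rewrite -uv; ring.
have czg : commute (zexp z u) (zexp g v).
  exact/commute_zexp/commute_sym/commute_zexp/commute_sym.
exists (zexp z u * zexp g v); rewrite zexpMg // -!zexpM.
  rewrite [(v * m)%R]mulrC (zexpM g) gm -!zexpM -zexpD.
  by rewrite (mulrC u) uvC /=.
rewrite [(u * k)%R]mulrC (zexpM z) -gm -!zexpM -zexpD.
by rewrite (mulrC v) uvC.
Qed.

Section AffineModel.
Variables (q n : nat) (k j : int) (s : bool).
Hypotheses (q_gt1 : (1 < q)%N) (n_gt0 : (0 < n)%N).
Hypotheses (qE : q = if s then (2 ^ n + 1)%N else (2 ^ n - 1)%N).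
Hypotheses (k_coprime : gcdz (2 * n)%N%:Z k = 1%Z).
Hypotheses (kE : k = (n%:Z + (2 * s)%N%:Z + 4 * j)%R).

Local Notation R := 'Z_q.
Local Notation T := (R * R)%type.

Lemma Zq_pow2 : (2 ^+ n = (if s then -1 else 1) :> R)%R.
Proof.
have q0 : (q%:R = 0 :> R)%R by rewrite pchar_Zp.
apply/eqP; rewrite -natrX; case: s qE => qs.
  rewrite -addr_eq0 natr1; have <- : q = (2 ^ n).+1 by rewrite qs addn1.
  by rewrite q0.
rewrite -subr_eq0 -(natrB _ (m := 2 ^ n) (n := 1)) ?expn_gt0 //.
by have <- : q = (2 ^ n - 1)%N by []; rewrite q0.
Qed.

(** Makes [similarity], of determinant 2, and [doubling] invertible. *)
Lemma Zq_half : exists c : R, (2 * c = 1)%R.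
Proof.
have := Zq_pow2; rewrite -(prednK n_gt0) exprS; case: s => e.
  by exists (- 2 ^+ n.-1)%R; rewrite mulrN e opprK.
by exists (2 ^+ n.-1)%R.
Qed.

(* With a pair (a, b) read as a + bi, these are the maps v |-> -i v, v |-> i v + 1,
   v |-> (1 - i) v and v |-> 2 v. Products of permutations compose from left to
   right. *)
Definition rotation (v : T) : T := (v.2, - v.1)%R.
Definition rotation_about (v : T) : T := (1 - v.2, v.1)%R.
Definition similarity (v : T) : T := (v.1 + v.2, v.2 - v.1)%R.
Definition doubling (v : T) : T := (v.1 * 2, v.2 * 2)%R.

Lemma rotation_inj : injective rotation.
Proof.
apply: (can_inj (g := fun v => (- v.2, v.1)%R)) => -[a b].
by rewrite /rotation /= opprK.
Qed.

Lemma rotation_about_inj : injective rotation_about.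
Proof.
apply: (can_inj (g := fun v => (v.2, 1 - v.1)%R)) => -[a b].
by rewrite /rotation_about /= opprB addrC subrK.
Qed.

Lemma similarity_inj : injective similarity.
Proof.
have [c c2] := Zq_half.
apply: (can_inj (g := fun v => ((v.1 - v.2) * c, (v.1 + v.2) * c)%R)) => -[a b].
rewrite /similarity /=; congr (_, _).
  by rewrite -[RHS]mulr1 -c2; ring.
by rewrite -[RHS]mulr1 -c2; ring.
Qed.

Lemma doubling_inj : injective doubling.
Proof.
have [c c2] := Zq_half.
apply: (can_inj (g := fun v => (v.1 * c, v.2 * c)%R)) => -[a b].
by rewrite /doubling /= -!mulrA c2 !mulr1.
Qed.

Let z := perm rotation_inj.
Let t := perm rotation_about_inj.
Let g := perm similarity_inj.
Let d := perm doubling_inj.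

Lemma rotation_order4 : z ^+ 4 = 1.
Proof.
by apply/permP => -[a b]; rewrite /= !permM perm1 !permE /rotation /= !opprK.
Qed.

Lemma rotation_about_order4 : t ^+ 4 = 1.
Proof.
apply/permP => -[a b]; rewrite /= !permM perm1 !permE /rotation_about /=.
by congr (_, _); ring.
Qed.

Lemma rotation_similarityC : commute z g.
Proof.
apply/permP => -[a b]; rewrite !permM !permE /rotation /similarity /=.
by congr (_, _); ring.
Qed.

Lemma rotation_about_similarity : t ^ g = t ^+ 2 * z.
Proof.
apply: (mulgI g); rewrite -conjgC; apply/permP => -[a b].
rewrite expg2 !permM !permE /rotation /rotation_about /similarity /=.
by congr (_, _); ring.
Qed.

(** Here $(1-i)^{2n} = 2^n (-i)^n$, and $2^n = \pm 1$ in ['Z_q] is the scalar by which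
    [z ^+ (2 * s)] acts. This is the compatibility that [common_root] asks for. *)
Lemma similarity_pow : zexp g (2 * n)%N%:Z = zexp z k.
Proof.
have g2 : g ^+ 2 = d * z.
  apply/permP => -[a b].
  rewrite expg2 !permM !permE /rotation /doubling /similarity /=.
  by congr (_, _); ring.
have dz : commute d z.
  apply/permP => -[a b]; rewrite !permM !permE /rotation /doubling /=.
  by congr (_, _); ring.
have dX i v : (d ^+ i) v = (v.1 * 2 ^+ i, v.2 * 2 ^+ i)%R.
  elim: i => [|i IH]; first by rewrite perm1 !mulr1; case: v.
  by rewrite expgSr permM IH permE /doubling /= -!mulrA -!exprSr.
have dn : d ^+ n = z ^+ (2 * s)%N.
  apply/permP => -[a b]; rewrite dX Zq_pow2; case: (s) => /=.
    by rewrite expg2 permM !permE /rotation /= !mulrN1.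
  by rewrite perm1 !mulr1.
rewrite /= expgnA g2 expgMn // dn -expgnDr.
rewrite kE addrAC !zexpD [zexp z (4 * j)]zexpM [zexp z 4]rotation_order4 /=.
case: (j) => p; rewrite /= expg1n ?invg1 mulg1 -expgnDr addnC //.
Qed.

Lemma affine_model : exists t0 y0 : {perm T},
  [/\ t0 ^+ 4 = 1, t0 ^ zexp y0 k = t0 ^+ 2 * y0 ^+ (2 * n)%N
    & forall a b, ((y0 ^+ (2 * n)%N * t0) ^+ a * (t0 * y0 ^+ (2 * n)%N) ^+ b)
        (0, 0)%R = (a%:R, - b%:R)%R].
Proof.
have [u [v uv]] := Bezoutz (2 * n)%N k; rewrite k_coprime in uv.
have [y0 yz yg] := common_root rotation_similarityC similarity_pow uv.
exists t, y0; rewrite yg -[y0 ^+ _]/(zexp y0 (2 * n)%N) yz.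
split=> [||a b]; first exact: rotation_about_order4.
  exact: rotation_about_similarity.
(* [z * t] and [t * z] are the translations by $1$ and $-i$, so the image of the origin records both
   exponents modulo [q]. *)
have XE : z * t = perm (@addrI T (1, 0)%R).
  apply/permP => -[a' b']; rewrite permM !permE /rotation_about /rotation /=.
  by congr (_, _); rewrite /= ?opprK ?add0r.
have YE : t * z = perm (@addrI T (0, -1)%R).
  apply/permP => -[a' b']; rewrite permM !permE /rotation_about /rotation /=.
  by congr (_, _) => /=; ring.
have trans (w x : T) i :
    (perm (@addrI T w) ^+ i) x = (x.1 + w.1 *+ i, x.2 + w.2 *+ i)%R.
  elim: i => [|i IH]; first by rewrite perm1 !addr0; case: x.
  by rewrite expgSr permM IH permE !mulrS (addrCA x.1) (addrCA x.2).
by rewrite XE YE permM !trans /= !mul0rn !add0r addr0 mulNrn.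
Qed.

End AffineModel.

(** * Transfer to the presented group and the isomorphism *)

Lemma presented_ind (X : choiceType) (R : seq (word X)) (S : presented R -> Prop) :
  S 1 -> (forall u v, S u -> S v -> S (u * v)) -> (forall u, S u -> S u^-1) ->
  (forall x, S (pgen R x)) -> forall u, S u.
Proof.
move=> S1 SM SV Sgen u; rewrite -(pclass_repr u) pclassE.
apply: (big_ind S) => // -[x b] _; case: b => //=; exact/SV/Sgen.
Qed.

Lemma multiplicativeXn (G H : groupType) (f : {multiplicative G -> H}) x p :
  f (x ^+ p) = f x ^+ p.
Proof.
elim: p => [|p IH]; last by rewrite !expgS gmulfM IH.
by apply: (mulgI (f 1)); rewrite -gmulfM !mulg1.
Qed.

Section DerivedJ4.
Variables (n : nat) (k j : int) (s : bool).
Let q := if s then (2 ^ n + 1)%N else (2 ^ n - 1)%N.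
Hypotheses (n_gt0 : (0 < n)%N) (k_coprime : gcdz (2 * n)%N%:Z k = 1%Z).
Hypotheses (kE : k = (n%:Z + (2 * s)%N%:Z + 4 * j)%R).

Local Notation m := (Posz (2 * n)%N).
Let t : J4 m k := pgen _ J4_t.
Let y : J4 m k := pgen _ J4_y.

Lemma J4_t4 : t ^+ 4 = 1.
Proof.
rewrite -[LHS]/(zexp t 4) -(weval_wpow (pgen _)) -pclassE.
by apply/pclassP/PresRelator; rewrite mem_head.
Qed.

Lemma J4_conj : t ^ zexp y k = t ^+ 2 * y ^+ (2 * n)%N.
Proof.
apply/(J4_relatorE y m k J4_t4).
rewrite -[t ^+ 3]/(zexp t 3) -[t ^+ 2]/(zexp t 2).
rewrite -!(weval_wpow (pgen _)) -!weval_cat -pclassE.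
by apply/pclassP/PresRelator; rewrite !inE eqxx orbT.
Qed.

Lemma J4_generated (S : J4 m k -> Prop) : S 1 ->
  (forall u v, S u -> S v -> S (u * v)) -> (forall u, S u -> S u^-1) ->
  S t -> S y -> forall x, S x.
Proof. by move=> S1 SM SV St Sy; apply: presented_ind => // -[]. Qed.

Let X := y ^+ (2 * n)%N * t.
Let Y := t * y ^+ (2 * n)%N.

Lemma J4_derivedP x : x \in @derived_pred (J4 m k) <-> lattice t y n x.
Proof. exact: derivedP n_gt0 k_coprime kE J4_t4 J4_conj J4_generated x. Qed.

Lemma J4_affine : (1 < q)%N ->
  exists f : {multiplicative J4 m k -> {perm 'Z_q * 'Z_q}},
    forall a b, f (X ^+ a * Y ^+ b) (0, 0)%R = (a%:R, - b%:R)%R.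
Proof.
move=> q_gt1.
have [t0 [y0 [t4 tg XYE]]] := affine_model q_gt1 n_gt0 erefl k_coprime kE.
pose f0 x := if x == J4_y then y0 else t0.
have [|f fE _] := @presented_ump _ [:: wpow J4_t 4;
   wpow J4_y (m - k)%R ++ wpow J4_t 3 ++ wpow J4_y k ++ wpow J4_t 2] _ f0.
  move=> r; rewrite !inE => /orP[]/eqP ->; first by rewrite weval_wpow.
  by rewrite !weval_cat !weval_wpow; apply/J4_relatorE.
exists f => a b.
by rewrite gmulfM !multiplicativeXn !gmulfM multiplicativeXn !fE /f0 /= XYE.
Qed.

Lemma J4_derived_isomorphic :
  isomorphic (derived (J4 m k)) (cyc q * cyc q)%type.
Proof.
have q_gt0 : (0 < q)%N := q_gt0 s n_gt0.
have X_torsion : X ^+ q = 1 := X_torsion kE J4_t4 J4_conj.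
have Y_torsion : Y ^+ q = 1 := Y_torsion kE J4_t4 J4_conj.
have XY : commute X Y := zt_tz_commute J4_t4 (zg_commute y n k) J4_conj.
pose C := 'I_q.-1.+1.
have hD (c : C * C) : X ^+ c.1 * Y ^+ c.2 \in @derived_pred (J4 m k).
  by apply/J4_derivedP; exists c.1, c.2.
pose h (c : C * C) : derived (J4 m k) := Sub (X ^+ c.1 * Y ^+ c.2) (hD c).
have hM (c c' : cyc q * cyc q) : h (c * c') = h c * h c'.
  apply: val_inj; rewrite valM /=.
  have expD (a b : cyc q) (x : J4 m k) : x ^+ q = 1 ->
      x ^+ (a * b)%g = x ^+ a * x ^+ b.
    move=> xq; rewrite -expgnDr -[RHS](expg_modn _ xq).
    (* The law of [cyc q] is addition modulo [q.-1.+1], which is [q]. *)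
    by congr (_ ^+ _); congr (_ %% _)%N; exact: prednK.
  rewrite !expD // !mulgA; congr (_ * _); rewrite -!mulgA; congr (_ * _).
  exact: commuteX2.
have h_surj (x : derived (J4 m k)) : exists c, h c = x.
  have [a [b xE]] := (J4_derivedP (val x)).1 (valP x).
  exists (inord (a %% q), inord (b %% q)); apply: val_inj => /=.
  rewrite xE !inordK ?prednK ?ltn_pmod //.
  by rewrite !expg_modn.
have h_inj : injective h.
  move=> c c' /(congr1 val) /= cc'.
  (* For [q = 1] the ring ['Z_q] has two elements and the affine model does not apply, but [C] is
     then a singleton. *)
  have [q_le1|q_gt1] := leqP q 1.
    have C1 (a b : C) : a = b.
      have q1 : q.-1 = 0%N by case: (q) q_le1 => [|[]].
      apply: val_inj; case: a b => [a +] [b +] /=; rewrite q1.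
      by case: a b => [|?] [|?].
    rewrite [c]surjective_pairing (C1 c.1 c'.1) (C1 c.2 c'.2).
    by rewrite -surjective_pairing.
  have [f fE] := J4_affine q_gt1.
  have := congr1 (fun u => f u (0, 0)%R) cc'; rewrite !fE => fcc'.
  have e1 : (c.1%:R = c'.1%:R)%R := congr1 fst fcc'.
  have e2 : (c.2%:R = c'.2%:R)%R := oppr_inj (congr1 snd fcc').
  have val_nat (a b : C) : (a%:R = b%:R :> 'Z_q)%R -> a = b.
    have ltq (i : C) : (i < q)%N by rewrite -[X in (_ < X)%N](prednK q_gt0).
    move/(congr1 val); rewrite /= !val_Zp_nat // !modn_small //; exact: val_inj.
  rewrite [c]surjective_pairing (val_nat _ _ e1) (val_nat _ _ e2).
  by rewrite -surjective_pairing.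
(* The isomorphism is the inverse of the bijective morphism [h]. *)
have [f hf] := choice h_surj.
have fM : {morph f : x x' / x * x'}.
  by move=> x x'; apply: h_inj; rewrite hM !hf.
exists (Multiplicative.Pack (Multiplicative.Class
  (isMultiplicative.Build (derived (J4 m k)) (cyc q * cyc q)%type f fM))).
by exists h => [x|c] /=; [exact: hf | apply: h_inj; exact: hf].
Qed.

End DerivedJ4.

Theorem theorem6p1 (m : nat) (k : int) (hm : (1 <= m)%N)
    (hgcd : gcdz m%:Z k = 1%Z)
    (hmk : (m%:Z - 2 * k = 0 %[mod 4])%Z) :
  ((m%:Z - 2 * k = 0 %[mod 8])%Z ->
     isomorphic (derived (J4 m%:Z k))
       (cyc (2 ^ (m %/ 2) - 1)%N * cyc (2 ^ (m %/ 2) - 1)%N)%type) /\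
  ((m%:Z - 2 * k = 4 %[mod 8])%Z ->
     isomorphic (derived (J4 m%:Z k))
       (cyc (2 ^ (m %/ 2) + 1)%N * cyc (2 ^ (m %/ 2) + 1)%N)%type).
Proof.
have [n mE] : exists n, m = (2 * n)%N.
  (* [m] is even because it is congruent to $2k$ modulo 4. *)
  by exists (m %/ 2)%N; lia.
rewrite mE mulKn //; rewrite mE in hm hgcd hmk *.
have n_gt0 : (0 < n)%N by lia.
split=> mk8.
  (* Halving $2n - 2k \equiv 0$ mod 8 gives $k \equiv n$ mod 4; in the other case $k \equiv n + 2$
     mod 4. *)
  have [j kE] : exists j : int, (k = n%:Z + (2 * false)%N%:Z + 4 * j)%R.
    exists ((k - n%:Z) %/ 4)%Z; lia.
  exact: (J4_derived_isomorphic n_gt0 hgcd kE).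
have [j kE] : exists j : int, (k = n%:Z + (2 * true)%N%:Z + 4 * j)%R.
  exists ((k - n%:Z) %/ 4)%Z; lia.
exact: (J4_derived_isomorphic n_gt0 hgcd kE).
Qed.
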